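(* For $R=\mathbb{Z}_{25}$ and for $R=\mathbb{S}_5=\mathbb{F}_5[X]/(X^2)$ we have $\mathrm{m}_3(R)\le 43$.
   Context: For a finite chain ring $R$ of length $2$ with residue field $\mathbb{F}_q$, the projective Hjelmslev plane $\mathrm{PHG}(2,R)$ is the incidence structure whose points are the free rank-$1$ submodules of the right module $R_R^3$, whose lines are the free rank-$2$ submodules of $R_R^3$, with incidence given by inclusion. A projective $(k,n)$-arc is a set of $k$ points meeting every line in at most $n$ points. For $0\le n\le q^2+q$, $\mathrm{m}_n(R)$ denotes the largest $k$ such that a projective $(k,n)$-arc exists in $\mathrm{PHG}(2,R)$. *)

(* Defs.v *)
From HB Require Import structures.
From mathcomp Require Import all_boot all_order all_algebra.
Set Implicit Arguments. Unset Strict Implicit. Unset Printing Implicit Defensive.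
Import GRing.Theory.
Local Open Scope ring_scope.

(* Projective Hjelmslev plane PHG(2,R) over a finite commutative ring R,
   realized inside the module R^3 = 'rV[R]_3 (row vectors). *)

Definition free_submod (R : finComNzRingType) (k : nat) (S : {set 'rV[R]_3}) : bool :=
  [exists B : 'M[R]_(k, 3),
     injectiveb (fun c : 'rV[R]_k => c *m B) && (S == [set c *m B | c : 'rV[R]_k])].

Definition phg_point (R : finComNzRingType) (S : {set 'rV[R]_3}) := free_submod 1 S.
Definition phg_line (R : finComNzRingType) (S : {set 'rV[R]_3}) := free_submod 2 S.

Definition proj_arc (R : finComNzRingType) (n : nat) (K : {set {set 'rV[R]_3}}) : bool :=
  [forall P in K, phg_point P] &&
  [forall L : {set 'rV[R]_3}, phg_line L ==> (#|[set P in K | P \subset L]| <= n)%N].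

Definition m_arc (R : finComNzRingType) (n : nat) : nat :=
  \max_(K : {set {set 'rV[R]_3}} | proj_arc n K) #|K|.

Definition S5 : Type := {poly %/ ('X^2 : {poly 'F_5})}.
HB.instance Definition _ := GRing.ComNzRing.on S5.
HB.instance Definition _ := Finite.on S5.

(* Main.v *)
Require Import Defs.
From HB Require Import structures.
From mathcomp Require Import all_boot all_order all_algebra zify ring.
Set Implicit Arguments. Unset Strict Implicit. Unset Printing Implicit Defensive.
Import GRing.Theory.

(** Both rings consist of the elements [a + b theta] with digits [a, b] mod 5,
    where [theta ^ 2 = 0] and [5 = kappa theta], with [kappa = 1] for [Z_25] and
    [kappa = 0] for [S_5].  Hence a point is a pair [(p, a)] of a point [p] of
    PG(2,5) and a lift [a], a line is a dual pair [(l, b)], and incidence means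
    [p.l = 0] and [c(p, l) + a.l + b.p = 0] mod 5; the argument works for every
    function [c].

    Suppose that an arc has 44 points.  For a line [l] of PG(2,5) the 25 lines
    above [l] form an affine plane whose 30 lines are the segments cut out in the
    6 neighbour classes on [l], and every point of it has weight at most 3.
    Summing over the 5 points of a segment with [n] arc points, the other classes
    on [l] contain at most [15 - 5 n] arc points.  Adding this up over the 6 lines
    through a class of [u] arc points bounds the arc and excludes [u >= 5].  For
    [u = 4] and [u = 3] it does so after improving the bound on the weight of a
    line of PG(2,5) on which no segment is doubled: to 13 by divisibility, and to
    11 because PG(2,5) has no (12,3)-arc.  So all classes have [u <= 2].  A class
    with [u = 2] has one direction in which its two points share a segment; the
    corresponding line has weight [w <= 7], and different classes give different
    lines.  Each of these lines contributes at least 12 to the sum of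
    [(w - 10)(w - 11)] over all lines, which double counting evaluates to
    [10 n2 + 22], where [n2 >= 13] is the number of classes with [u = 2]:
    a contradiction. *)

(** * The lines above a line of PG(2,5) *)

Definition F5 : seq nat := [:: 0; 1; 2; 3; 4].
Definition slots : seq nat := [:: 0; 1; 2; 3; 4; 5].
Definition grid : seq (nat * nat) := [seq (x, y) | x <- F5, y <- F5].

Arguments F5 : simpl never.
Arguments slots : simpl never.
Arguments grid : simpl never.

(* The six parallel classes of AG(2,5): [slot 0] is the direction [y], and
   [slot t.+1] the direction [x + t y]. *)
Definition slot (j : nat) (z : nat * nat) : nat :=
  if j is t.+1 then (z.1 + t * z.2) %% 5 else z.2.

(* [g j e] is the weight of the line [slot j z = e] of AG(2,5). *)
Definition line_bounded (g : nat -> nat -> nat) : Prop :=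
  {in grid, forall z, \sum_(j <- slots) g j (slot j z) <= 3}.

Definition total (h : nat -> nat) : nat := \sum_(e <- F5) h e.

Definition segment j e := [seq z <- grid | slot j z == e].

Lemma perm_segment_slot j e i : j \in slots -> e \in F5 -> i \in slots ->
  perm_eq [seq slot i z | z <- segment j e] (if i == j then nseq 5 e else F5).
Proof.
have : all (fun j => all (fun e => all (fun i => perm_eq
  [seq slot i z | z <- segment j e] (if i == j then nseq 5 e else F5)) slots) F5)
  slots by vm_compute.
by move/allP => h /h /allP{}h /h /allP{}h /h.
Qed.

(** Adding the bound over the five points of [segment j e] counts this line five times and each line
    of another direction once. *)
Lemma segment_bound g j e : line_bounded g -> j \in slots -> e \in F5 ->
  5 * g j e + \sum_(i <- slots) total (g i) <= 15 + total (g j).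
Proof.
move=> hg hj he.
have sz : size (segment j e) = 5.
  have := perm_size (perm_segment_slot hj he hj).
  by rewrite size_map eqxx size_nseq.
have : \sum_(z <- segment j e) \sum_(i <- slots) g i (slot i z) <= 15.
  rewrite -[15]/(3 * 5) -sz -sum1_size big_distrr /= big_seq [X in _ <= X]big_seq.
  by apply: leq_sum => z; rewrite mem_filter => /andP[_ /hg]; rewrite muln1.
rewrite exchange_big /= (bigD1_seq j) //= [in X in _ -> X](bigD1_seq j) //=.
have eqi i : i \in slots -> \sum_(z <- segment j e) g i (slot i z) =
    if i == j then 5 * g j e else total (g i).
  move=> hi; rewrite -(big_map (slot i) xpredT (g i)).
  rewrite (perm_big _ (perm_segment_slot hj he hi)).
  by case: eqP => // ->; rewrite big_nseq iter_addn_0 mulnC.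
rewrite eqi // eqxx.
have -> : \sum_(i <- slots | i != j) \sum_(z <- segment j e) g i (slot i z) =
    \sum_(i <- slots | i != j) total (g i).
  rewrite big_seq_cond [RHS]big_seq_cond; apply: eq_bigr => i /andP[hi /negbTE nij].
  by rewrite eqi // nij.
lia.
Qed.

Lemma segments_meet i j e e' : i \in slots -> j \in slots -> i != j ->
  e \in F5 -> e' \in F5 -> exists2 z, z \in grid & slot i z = e /\ slot j z = e'.
Proof.
move=> hi hj nij he he'.
have := perm_mem (perm_segment_slot hi he hj) e'.
rewrite eq_sym (negbTE nij) he' => /mapP[z].
by rewrite mem_filter => /andP[/eqP zi zg] ->; exists z.
Qed.

Definition bitvectors (n : nat) : seq (seq nat) :=
  iter n (fun ms => [seq b :: m | b <- [:: 0; 1], m <- ms]) [:: [::]].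
(** The patterns left for one direction of a 0/1 weighting of total weight 12. *)
Definition masks : seq (seq nat) :=
  [seq m <- bitvectors 5 | sumn m \in [:: 0; 2; 3]].
(* Up to cyclic shift, the 0/1-vectors of weight 0, 2 or 3; translating the plane
   brings the first two directions to this form. *)
Definition canonical_masks : seq (seq nat) :=
  [:: [:: 0; 0; 0; 0; 0]; [:: 1; 1; 0; 0; 0]; [:: 1; 0; 1; 0; 0];
      [:: 1; 1; 1; 0; 0]; [:: 1; 1; 0; 1; 0]].

Definition coverage (j : nat) (m : seq nat) : seq nat :=
  [seq nth 0 m (slot j z) | z <- grid].

Definition covers (j : nat) : seq (seq nat) :=
  [seq coverage j m | m <- if j < 2 then canonical_masks else masks].

(* No choice of one cover per direction has total weight 12 and all point weights
   at most 3; each line covers 5 points, whence the 60 and the 15. *)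
Fixpoint no_dual_arc (cs : seq (seq (seq nat))) (f : seq nat) : bool :=
  if cs is c :: cs' then
    if sumn f + 15 * size cs < 60 then true else
    all (fun v => let f' := [seq p.1 + p.2 | p <- zip f v] in
                  if all (fun k => k <= 3) f' then no_dual_arc cs' f' else true) c
  else sumn f != 60.

Lemma no_dual_arc_slots : no_dual_arc [seq covers j | j <- slots] (nseq 25 0).
Proof. by vm_compute. Qed.

Lemma no_dual_arc_cons c cs f : no_dual_arc (c :: cs) f =
  if sumn f + 15 * (size cs).+1 < 60 then true else
  all (fun v => let f' := [seq p.1 + p.2 | p <- zip f v] in
                if all (fun k => k <= 3) f' then no_dual_arc cs f' else true) c.
Proof. by []. Qed.

Lemma map_add_zip (T : Type) (F H : T -> nat) (s : seq T) :
  [seq p.1 + p.2 | p <- zip [seq F z | z <- s] [seq H z | z <- s]] =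
  [seq F z + H z | z <- s].
Proof. by elim: s => //= z s ->. Qed.

(** Soundness of the search: [F] holds the weight already collected at each point, and the induction
    adds one direction at a time. *)
Lemma no_dual_arcP (g : nat -> nat -> nat) (js : seq nat) (F : nat * nat -> nat) :
  {subset js <= slots} ->
  {in js, forall j, [seq g j (slot j z) | z <- grid] \in covers j} ->
  {in grid, forall z, F z + \sum_(j <- js) g j (slot j z) <= 3} ->
  no_dual_arc [seq covers j | j <- js] [seq F z | z <- grid] ->
  \sum_(z <- grid) (F z + \sum_(j <- js) g j (slot j z)) != 60.
Proof.
have cover15 j : j \in slots -> {in covers j, forall v, sumn v <= 15}.
  have /allP h : all (fun j => all (fun v => sumn v <= 15) (covers j)) slots.
    by vm_compute.
  by move/h/allP.
elim: js F => [|j js IH] F sub cov bound.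
  rewrite -[no_dual_arc _ _]/(sumn [seq F z | z <- grid] != 60) sumnE big_map.
  by under [in X in _ -> X]eq_bigr do rewrite big_nil addn0.
have hj : j \in slots by apply: sub; rewrite mem_head.
have subs : {subset js <= slots} by move=> i hi; apply: sub; rewrite inE hi orbT.
have covs : {in js, forall j, [seq g j (slot j z) | z <- grid] \in covers j}.
  by move=> i hi; apply: cov; rewrite inE hi orbT.
have sumE z : F z + \sum_(j <- j :: js) g j (slot j z) =
    F z + g j (slot j z) + \sum_(j <- js) g j (slot j z).
  by rewrite big_cons addnA.
under [in X in _ -> X]eq_bigr do rewrite sumE.
rewrite map_cons no_dual_arc_cons; case: ifP => [small _ | _ /allP h].
  suff : \sum_(z <- grid) (F z + \sum_(i <- j :: js) g i (slot i z)) <=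
      sumn [seq F z | z <- grid] + 15 * (size js).+1.
    under eq_bigr do rewrite sumE.
    rewrite size_map in small; lia.
  rewrite sumnE big_map big_split leq_add2l exchange_big /=.
  rewrite -[(size js).+1]/(size (j :: js)) -sum1_size big_distrr /=.
  rewrite big_seq [X in _ <= X]big_seq; apply: leq_sum => i hi.
  rewrite muln1 -(big_map (fun z => g i (slot i z)) xpredT id) -sumnE.
  by apply: (cover15 i (sub i hi)); apply: cov.
apply: IH => //.
  by move=> z zg; rewrite -sumE; apply: bound.
have := h _ (cov j (mem_head _ _)); cbv zeta; rewrite map_add_zip.
case: ifP => // /negbT/negP[].
by apply/allP => _ /mapP[z zg ->]; have := bound z zg; rewrite sumE; lia.
Qed.

Lemma mem_bitvectors (n : nat) (m : seq nat) :
  size m = n -> all (fun b => b <= 1) m -> m \in bitvectors n.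
Proof.
elim: n m => [[]//|n IH] [//|b m] [szm] /andP[b1 hm].
rewrite /bitvectors iterS; apply/allpairsP; exists (b, m); split=> //=; last exact: IH.
by case: b b1 => [|[]].
Qed.

Lemma mod5_F5 n : n %% 5 \in F5.
Proof.
have := ltn_pmod n (isT : 0 < 5).
by case: (_ %% 5) => [|[|[|[|[|]]]]].
Qed.

Lemma nth_map_F5 (h : nat -> nat) e : e \in F5 -> nth 0 [seq h i | i <- F5] e = h e.
Proof. by rewrite !inE => /or4P[|||/orP[]] /eqP->. Qed.

Lemma slot_F5 j z : z \in grid -> slot j z \in F5.
Proof.
case: z => x y /allpairsP[[x' y'] /= [xF yF [-> ->]]]; case: j => //= t.
exact: mod5_F5.
Qed.

Lemma sum_grid_slot (h : nat -> nat) j : j \in slots ->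
  \sum_(z <- grid) h (slot j z) = 5 * total h.
Proof.
move=> hj; rewrite -(big_map (slot j) xpredT h).
have /allP/(_ _ hj) : all (fun j => perm_eq [seq slot j z | z <- grid]
  (F5 ++ F5 ++ F5 ++ F5 ++ F5)) slots by vm_compute.
move=> /(perm_big _) ->; rewrite !big_cat /= -!/(total h); lia.
Qed.

Definition shift (c : nat * nat) (g : nat -> nat -> nat) (j e : nat) : nat :=
  g j ((e + slot j c) %% 5).

Lemma total_shift c g j : c \in grid -> total (shift c g j) = total (g j).
Proof.
move=> cg; have /allP/(_ _ (slot_F5 j cg)) /(perm_big _) e :
  all (fun k => perm_eq F5 [seq (e + k) %% 5 | e <- F5]) F5 by [].
by rewrite {2}/total e big_map.
Qed.

Lemma line_bounded_shift c g : c \in grid -> line_bounded g -> line_bounded (shift c g).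
Proof.
move=> cg hg z zg.
have /allP/(_ _ cg)/allP/(_ _ zg)/andP[hz /allP hs] : all (fun c => all (fun z =>
    let w := ((z.1 + c.1) %% 5, (z.2 + c.2) %% 5) in (w \in grid) &&
    all (fun j => (slot j z + slot j c) %% 5 == slot j w) slots) grid) grid.
  by vm_compute.
apply: leq_trans (hg _ hz); rewrite big_seq [X in _ <= X]big_seq.
by apply: leq_sum => j /hs/eqP; rewrite /shift => ->.
Qed.

Lemma mem_masks (h : nat -> nat) :
  {in F5, forall e, h e <= 1} -> total h \in [:: 0; 2; 3] ->
  [seq h e | e <- F5] \in masks.
Proof.
move=> h1 ht; rewrite mem_filter sumnE big_map ht.
by apply: mem_bitvectors => //; apply/allP => _ /mapP[e /h1 he ->].
Qed.

(** Dual form of the nonexistence of a (12,3)-arc in PG(2,5): the chosen lines are points of the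
    dual plane, with at most 3 through each affine point and each point at infinity. *)
Lemma dual_arc_bound g : line_bounded g ->
  {in slots, forall j, {in F5, forall e, g j e <= 1}} ->
  {in slots, forall j, total (g j) <= 3} ->
  \sum_(j <- slots) total (g j) <= 11.
Proof.
move=> hg g1 t3; rewrite leqNgt; apply/negP => W12.
have t_cases j : j \in slots -> total (g j) = 0 \/
    \sum_(i <- slots) total (g i) <= 10 + total (g j).
  move=> hj; have [h0|/allPn[e he ne0]] := boolP (all (fun e => g j e == 0) F5).
    by left; rewrite /total big_seq big1 // => e /(allP h0)/eqP.
  by right; have := segment_bound hg hj he; lia.
(* Some total is nonzero, so the weight is at most 13; at 13 all nonzero totals would be 3, and 3
   does not divide 13. *)
have W : \sum_(j <- slots) total (g j) = 12.
  have tc j (hj : j \in slots) := (t_cases j hj, t3 j hj).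
  have := (tc 0 isT, tc 1 isT, tc 2 isT); have := (tc 3 isT, tc 4 isT, tc 5 isT).
  rewrite /slots !big_cons !big_nil in W12 *.
  by move=> [[[? ?] [? ?]] [? ?]] [[[? ?] [? ?]] [? ?]]; lia.
have t023 : {in slots, forall j, total (g j) \in [:: 0; 2; 3]}.
  by move=> j hj; move: (t_cases j hj) (t3 j hj); rewrite W !inE; lia.
have canon j : j \in slots ->
    {k | k \in F5 & [seq g j ((e + k) %% 5) | e <- F5] \in canonical_masks}.
  move=> hj; have mj := mem_masks (g1 j hj) (t023 j hj).
  have /allP/(_ _ mj)/hasP/sig2W[k kF kc] : all (fun m => has (fun k =>
      [seq nth 0 m ((e + k) %% 5) | e <- F5] \in canonical_masks) F5) masks.
    by vm_compute.
  exists k => //; apply: etrans kc; congr in_mem; apply/eq_map => e.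
  by apply/esym/nth_map_F5; apply: mod5_F5.
have [c cF c0] := canon 0 isT; have [d dF d1] := canon 1 isT.
(* [slot 0] is y and [slot 1] is x, so the translation by [(d, c)] makes both masks canonical. *)
have dcg : (d, c) \in grid by apply/allpairsP; exists (d, c).
have covs : {in slots, forall j,
    [seq shift (d, c) g j (slot j z) | z <- grid] \in covers j}.
  move=> j hj; have -> : [seq shift (d, c) g j (slot j z) | z <- grid] =
      coverage j [seq shift (d, c) g j e | e <- F5].
    by apply/eq_in_map => z zg; rewrite nth_map_F5 // slot_F5.
  apply: map_f; case: ifP => [j2|_].
    case: j j2 {hj} => [|[|//]] _; first exact: c0.
    apply: etrans d1; congr in_mem; apply/eq_map => e.
    by rewrite /shift /= mul0n addn0 modnDmr.
  apply: mem_masks; last by rewrite total_shift ?t023.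
  by move=> e _; rewrite /shift g1 ?mod5_F5.
have := no_dual_arcP (F := fun=> 0) (fun _ => id) covs
  (line_bounded_shift dcg hg) no_dual_arc_slots.
rewrite exchange_big /= big_seq.
under eq_bigr => j hj do rewrite sum_grid_slot // total_shift //.
by rewrite -big_seq -big_distrr /= W.
Qed.

(** * The points of a neighbour class *)

Fixpoint combinations (T : Type) (k : nat) (s : seq T) : seq (seq T) :=
  if k is k'.+1 then
    if s is x :: s' then [seq x :: t | t <- combinations k' s'] ++ combinations k s'
    else [::]
  else [:: [::]].

Lemma mem_combinations (T : eqType) (t s : seq T) :
  subseq t s -> t \in combinations (size t) s.
Proof.
elim: s t => [|x s IH] [|y t] //=.
rewrite mem_cat; case: eqP => [->|_] /IH h; last by rewrite h orbT.
by rewrite map_f.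
Qed.

(** For the [slot j] values of a point set, this is the largest number of its points on a common
    line of that direction. *)
Definition peak (vs : seq nat) : nat := foldr maxn 0 [seq count_mem e vs | e <- F5].

Definition peaks (T : seq (nat * nat)) : seq nat :=
  [seq peak [seq slot j z | z <- T] | j <- slots].

Definition peaks_check (P : pred (seq nat)) (T : seq (nat * nat)) : bool :=
  let ms := peaks T in if all (fun m => m <= 3) ms then P ms else true.

Definition peaks2 (ms : seq nat) : bool := 2 \in ms.
(** The six lines of PG(2,5) through a class of u arc points have total weight 44 + 5 u, and a line
    whose largest segment there holds m arc points weighs at most 15 + u - 5 m. [peaks3] and
    [peaks4] keep the sum below the required 59 and 64; [peaks5] keeps it at most 120 - 55 < 69. *)
Definition peaks3 (ms : seq nat) : bool := sumn [seq minn 11 (18 - 5 * m) | m <- ms] <= 58.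
Definition peaks4 (ms : seq nat) : bool := sumn [seq minn 13 (19 - 5 * m) | m <- ms] <= 63.
Definition peaks5 (ms : seq nat) : bool := 11 <= sumn ms.

Lemma peaks2_check : all (peaks_check peaks2) (combinations 2 grid).
Proof. by vm_compute. Qed.
Lemma peaks3_check : all (peaks_check peaks3) (combinations 3 grid).
Proof. by vm_compute. Qed.
Lemma peaks4_check : all (peaks_check peaks4) (combinations 4 grid).
Proof. by vm_compute. Qed.
Lemma peaks5_check : all (peaks_check peaks5) (combinations 5 grid).
Proof. by vm_compute. Qed.

Lemma eq_peaks T1 T2 : perm_eq T1 T2 -> peaks T1 = peaks T2.
Proof.
move=> h; apply/eq_map => j; congr foldr; apply/eq_map => e.
exact/permP/perm_map.
Qed.

Lemma peaks_checkP P n T : all (peaks_check P) (combinations n grid) ->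
  uniq T -> {subset T <= grid} -> size T = n -> all (fun m => m <= 3) (peaks T) ->
  P (peaks T).
Proof.
move=> h uT sT szT p3.
have hT : perm_eq T [seq z <- grid | z \in T].
  apply: uniq_perm => //; first exact: filter_uniq.
  by move=> z; rewrite mem_filter; case: (boolP (z \in T)) => // /sT ->.
have := allP h _ (_ : [seq z <- grid | z \in T] \in _).
rewrite -szT (perm_size hT) mem_combinations ?filter_subseq // => /(_ isT).
by rewrite /peaks_check -(eq_peaks hT) p3.
Qed.

Lemma peak_count vs : exists2 e, e \in F5 & peak vs = count_mem e vs.
Proof.
suff h (f : nat -> nat) (t : seq nat) : t != [::] ->
    exists2 e, e \in t & foldr maxn 0 [seq f e | e <- t] = f e.
  exact: h.
elim: t => // a [|b t] IH _; first by exists a; rewrite ?mem_head //= maxn0.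
have [//|e he /= ->] := IH; have [le|/ltnW le] := leqP (f a) (f e).
  by exists e; rewrite ?(maxn_idPr le) // inE he orbT.
by exists a; rewrite ?(maxn_idPl le) ?mem_head.
Qed.

Lemma size_peak vs : {subset vs <= F5} -> size vs <= 5 * peak vs.
Proof.
move=> sub; have -> : size vs = \sum_(e <- F5) count_mem e vs.
  elim: vs sub => [|v vs IH] sub; first by rewrite big1.
  rewrite big_split /= -IH; last by move=> x hx; apply: sub; rewrite inE hx orbT.
  have := sub v (mem_head _ _).
  by rewrite /F5 !inE => /or4P[|||/orP[]] /eqP->; rewrite !big_cons big_nil.
have le e : e \in F5 -> count_mem e vs <= peak vs.
  move=> he; rewrite /peak.
  elim: F5 he => // a t IH; rewrite inE => /predU1P[->|/IH h] /=; first exact: leq_maxl.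
  exact: leq_trans h (leq_maxr _ _).
rewrite -[X in X * _]/(size F5) -sum1_size big_distrl /=.
by rewrite big_seq [X in _ <= X]big_seq; apply: leq_sum => e /le; rewrite mul1n.
Qed.

Lemma uniq_map_inj (A B : eqType) (f : A -> B) (t : seq A) :
  uniq [seq f x | x <- t] -> {in t &, injective f}.
Proof.
elim: t => //= a t IH /andP[na /IH inj] x y; rewrite !inE.
move=> /predU1P[->|hx] /predU1P[->|hy] // e; last exact: inj.
  by rewrite e map_f in na.
by rewrite -e map_f in na.
Qed.

(** * Coordinates for PG(2,5) *)

Notation vec := (nat * nat * nat)%type.

(** Not reduced modulo 5: the quotient of [dot p l] by 5 is the carry that enters incidence over
    Z_25. *)
Definition dot (u v : vec) : nat := u.1.1 * v.1.1 + u.1.2 * v.1.2 + u.2 * v.2.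

Lemma dotC u v : dot u v = dot v u.
Proof. by rewrite /dot; congr (_ + _ + _); rewrite mulnC. Qed.

Definition pg : seq vec :=
  (0, 0, 1) :: [seq (0, 1, t) | t <- F5] ++ [seq (1, z.1, z.2) | z <- grid].
Arguments pg : simpl never.

(* Representatives of F_5^3 modulo [l]: the coordinate where [l] leads is 0. *)
Definition lifts (l : vec) : seq vec :=
  if l.1.1 != 0 then [seq (0, z.1, z.2) | z <- grid] else
  if l.1.2 != 0 then [seq (z.1, 0, z.2) | z <- grid] else
  [seq (z.1, z.2, 0) | z <- grid].

Definition orth (l : vec) : seq vec := [seq p <- pg | dot p l %% 5 == 0].

Arguments orth : simpl never.

(* In the order of [pg] the points of a line are [B, A, A + B, ..., A + 4 B], so
   the [j]-th one is the direction [slot j] in the coordinates [chart]. *)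
Definition orth_nth (l : vec) (j : nat) : vec := nth (0, 0, 0) (orth l) j.

Definition chart (l b : vec) : nat * nat :=
  (dot b (orth_nth l 1) %% 5, dot b (orth_nth l 0) %% 5).

Lemma uniq_pg : uniq pg. Proof. by vm_compute. Qed.

Lemma uniq_orth l : uniq (orth l). Proof. exact: filter_uniq uniq_pg. Qed.

Lemma mem_orth p l : p \in pg -> l \in pg -> (p \in orth l) = (l \in orth p).
Proof. by move=> hp hl; rewrite !mem_filter hp hl dotC. Qed.

Lemma orthE l : l \in pg -> orth l = [seq orth_nth l j | j <- slots].
Proof.
move=> hl; have /allP/(_ _ hl)/eqP // :
  all (fun l => orth l == [seq orth_nth l j | j <- slots]) pg by vm_compute.
Qed.

Lemma chart_slot l b j : l \in pg -> b \in lifts l -> j \in slots ->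
  dot b (orth_nth l j) %% 5 = slot j (chart l b).
Proof.
have : all (fun l => all (fun b => all (fun j =>
  dot b (orth_nth l j) %% 5 == slot j (chart l b)) slots) (lifts l)) pg.
  by vm_compute.
by move/allP => h /h/allP{}h /h/allP{}h /h/eqP.
Qed.

Lemma perm_chart l : l \in pg -> perm_eq [seq chart l b | b <- lifts l] grid.
Proof.
have /allP h : all (fun l => perm_eq [seq chart l b | b <- lifts l] grid) pg.
  by vm_compute.
exact: h.
Qed.

Lemma count_lines p q : p \in pg -> q \in pg ->
  count (fun l => (p \in orth l) && (q \in orth l)) pg = 1 + 5 * (p == q).
Proof.
have : all (fun p => all (fun q => count (fun l => (dot p l %% 5 == 0) &&
  (dot q l %% 5 == 0)) pg == 1 + 5 * (p == q)) pg) pg by vm_compute.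
move/allP => h hp hq; move/allP: (h _ hp) => /(_ _ hq)/eqP <-.
by apply: eq_count => l; rewrite !mem_filter hp hq !andbT.
Qed.

Lemma sum_count_fst (A B : eqType) (ps : seq A) (Q : pred (A * B)) (s : seq (A * B)) :
  uniq ps ->
  \sum_(p <- ps) count (fun z => (z.1 == p) && Q z) s =
  count (fun z => (z.1 \in ps) && Q z) s.
Proof.
move=> ups; elim: s => [|z s IH]; first by rewrite big1.
rewrite big_split /= IH; congr (_ + _); case: (Q z); rewrite ?andbT ?andbF.
  rewrite -(count_uniq_mem _ ups) -sum1_count [RHS]big_mkcond /=.
  by apply: eq_bigr => p _; rewrite andbT eq_sym; case: eqP.
by rewrite big1 // => p _; rewrite andbF.
Qed.

(** * Weights of neighbour classes and of lines of PG(2,5) *)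

Section Arc.

Variables (c : vec -> vec -> nat) (s : seq (vec * vec)).
Hypothesis us : uniq s.
Hypothesis sub_s : {in s, forall z, z.1 \in pg /\ z.2 \in lifts z.1}.
Hypothesis line_s : {in pg, forall l, {in lifts l, forall b,
  count (fun z => (dot z.1 l %% 5 == 0) &&
    ((c z.1 l + dot z.2 l + dot b z.1) %% 5 == 0)) s <= 3}}.

Definition class_size (p : vec) : nat := count (fun z => z.1 == p) s.

(** All lines [(l, b)] with [dot b p] congruent to [e] cut the class of [p] in the same segment, so
    [e] labels the segments. *)
Definition segment_size (l p : vec) (e : nat) : nat :=
  count (fun z => (z.1 == p) && ((c z.1 l + dot z.2 l + e) %% 5 == 0)) s.

Definition line_weight (l : vec) : nat := \sum_(p <- orth l) class_size p.

(** [chart l] turns the lines above [l] into the points of AG(2,5) and the segments into its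
    lines. *)
Lemma line_bounded_segment_size l : l \in pg -> line_bounded (fun j e => segment_size l (orth_nth l j) e).
Proof.
move=> hl z; rewrite -(perm_mem (perm_chart hl)) => /mapP[b hb ->].
apply: leq_trans (line_s hl hb); apply: eq_leq.
transitivity (\sum_(p <- orth l) count (fun z => (z.1 == p) &&
    ((c z.1 l + dot z.2 l + dot b z.1) %% 5 == 0)) s).
  rewrite orthE // big_map; apply: eq_big_seq => j hj.
  apply: eq_count => z'; rewrite -chart_slot // modnDmr.
  by case: eqP => //= ->.
rewrite sum_count_fst ?uniq_orth //; apply: eq_in_count => z' hz'.
by rewrite mem_filter (sub_s hz').1 andbT.
Qed.

Lemma total_segment_size l p : total (segment_size l p) = class_size p.
Proof.
rewrite /segment_size /class_size /total; elim: s => [|z t IH]; first by rewrite big1.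
rewrite big_split /= IH; congr (_ + _); case: eqP => _; last by rewrite big1.
rewrite /=; under eq_bigr do rewrite -modnDml.
have := mod5_F5 (c z.1 l + dot z.2 l).
by rewrite /F5 !inE => /or4P[|||/orP[]] /eqP->; rewrite !big_cons big_nil.
Qed.

Lemma line_weight_total l : l \in pg -> line_weight l = \sum_(j <- slots) total (segment_size l (orth_nth l j)).
Proof.
by move=> hl; rewrite /line_weight orthE // big_map; apply: eq_bigr => j _; rewrite total_segment_size.
Qed.

Lemma orthP l p : l \in pg -> p \in orth l -> exists2 j, j \in slots & p = orth_nth l j.
Proof. by move=> hl; rewrite {1}orthE // => /mapP. Qed.

Lemma segment_size_bound l p e : l \in pg -> p \in orth l -> e \in F5 ->
  5 * segment_size l p e + line_weight l <= 15 + class_size p.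
Proof.
move=> hl /(orthP hl)[j hj ->] he.
by have := segment_bound (line_bounded_segment_size hl) hj he; rewrite -line_weight_total // total_segment_size.
Qed.

(** A nonempty class has a segment with an arc point, so 5 + w <= 15 + u. *)
Lemma line_weight_bound l p : l \in pg -> p \in orth l -> 0 < class_size p -> line_weight l <= 10 + class_size p.
Proof.
move=> hl hp; rewrite -(total_segment_size l) => Up.
have [/hasP[e he G1]|/hasPn h] := boolP (has (fun e => 0 < segment_size l p e) F5).
  by have := segment_size_bound hl hp he; rewrite total_segment_size; lia.
move: Up; rewrite /total big_seq big1 // => e /h; lia.
Qed.

(** Segments in different classes on [l] lie on a common line above [l], which would contain at
    least four arc points. *)
Lemma double_segment_unique l p q e e' : l \in pg -> p \in orth l -> q \in orth l ->
  e \in F5 -> e' \in F5 -> 1 < segment_size l p e -> 1 < segment_size l q e' -> p = q.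
Proof.
move=> hl /(orthP hl)[i hi ->] /(orthP hl)[j hj ->] he he' Gp Gq.
have [->//|nij] := eqVneq i j.
have [z zg [zi zj]] := segments_meet hi hj nij he he'.
have := line_bounded_segment_size hl zg.
rewrite (bigD1_seq i) //= big_mkcond (bigD1_seq j) //= eq_sym nij zi zj; lia.
Qed.

(** Without a doubled segment [dual_arc_bound] applies; a doubled segment gives w <= 15 + 3 - 10 =
    8. *)
Lemma line_weight_le11 l p : l \in pg -> {in pg, forall q, class_size q <= 3} -> p \in orth l ->
  class_size p = 3 -> line_weight l <= 11.
Proof.
move=> hl U3 hp Up; have [h|] := boolP (all (fun q => all (fun e => segment_size l q e <= 1) F5) (orth l)).
  rewrite line_weight_total //; apply: dual_arc_bound (line_bounded_segment_size hl) _ _.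
    move=> j hj e he; move/allP: h => /(_ (orth_nth l j)); rewrite orthE // map_f //.
    by move=> /(_ isT)/allP/(_ _ he).
  move=> j hj; rewrite total_segment_size; apply: U3.
  by have := map_f (orth_nth l) hj; rewrite -orthE // mem_filter => /andP[].
move=> /allPn[q hq /allPn[e he Ge]].
by have := segment_size_bound hl hq he; have := U3 q; rewrite (mem_subseq (filter_subseq _ _) hq); lia.
Qed.

(** The class of [p] gives w <= 14. If w = 14, every nonempty class on [l] has exactly 4 arc points,
    but 4 does not divide 14. *)
Lemma line_weight_le13 l p : l \in pg -> {in pg, forall q, class_size q <= 4} -> p \in orth l ->
  class_size p = 4 -> line_weight l <= 13.
Proof.
move=> hl U4 hp Up.
have h j : j \in slots -> [/\ class_size (orth_nth l j) <= 4 &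
    class_size (orth_nth l j) = 0 \/ line_weight l <= 10 + class_size (orth_nth l j)].
  move=> hj; have hq : orth_nth l j \in orth l by rewrite orthE // map_f.
  split; first by apply/U4/(mem_subseq (filter_subseq _ _) hq).
  by case: (posnP (class_size (orth_nth l j))) => [|/(line_weight_bound hl hq)]; [left | right].
have : line_weight l = \sum_(j <- slots) class_size (orth_nth l j) by rewrite /line_weight orthE // big_map.
rewrite /slots !big_cons big_nil.
have [] := h 0 isT; have [] := h 1 isT; have [] := h 2 isT.
have [] := h 3 isT; have [] := h 4 isT; have [] := h 5 isT.
by have := line_weight_bound hl hp; lia.
Qed.

(** A class is an affine plane too; its segments in direction [slot j] are cut out by the lines
    above [orth_nth p j]. *)
Definition class_points (p : vec) : seq (nat * nat) := [seq chart p z.2 | z <- s & z.1 == p].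

Lemma size_class_points p : size (class_points p) = class_size p.
Proof. by rewrite size_map size_filter. Qed.

Lemma sub_class_points p : p \in pg -> {subset class_points p <= grid}.
Proof.
move=> hp _ /mapP[z + ->]; rewrite mem_filter => /andP[/eqP zp /sub_s[_]].
by rewrite zp -(perm_mem (perm_chart hp)) => /(map_f (chart p)).
Qed.

Lemma uniq_class_points p : p \in pg -> uniq (class_points p).
Proof.
move=> hp; rewrite map_inj_in_uniq ?filter_uniq // => -[p1 a1] [p2 a2].
rewrite !mem_filter => /andP[/eqP/= -> /sub_s[/= _ h1]] /andP[/eqP/= -> /sub_s[/= _ h2]] e.
congr (_, _); apply: (uniq_map_inj _ h1 h2 e).
by rewrite (perm_uniq (perm_chart hp)).
Qed.

Lemma peak_segment_size p j : p \in pg -> j \in slots ->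
  exists2 e, e \in F5 & peak [seq slot j z | z <- class_points p] = segment_size (orth_nth p j) p e.
Proof.
move=> hp hj; have [v vF ->] := peak_count [seq slot j z | z <- class_points p].
(* The label solves [c p l + v + e = 0] modulo 5; starting from 10 keeps the truncated subtraction
   exact. *)
set l := orth_nth p j; exists ((10 - c p l %% 5 - v) %% 5); first exact: mod5_F5.
rewrite !count_map count_filter; apply: eq_in_count => z hz /=.
rewrite andbC; case: eqP => //= zp; have := (sub_s hz).2; rewrite zp => /chart_slot.
move=> /(_ j hp hj); rewrite -/l => <-.
by move: vF; rewrite !inE; move: (dot _ _) (c _ _) => d k; lia.
Qed.

Lemma orth_nthP p j : p \in pg -> j \in slots ->
  orth_nth p j \in pg /\ p \in orth (orth_nth p j).
Proof.
move=> hp hj; have h : orth_nth p j \in orth p by rewrite orthE // map_f.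
have hq := mem_subseq (filter_subseq _ _) h.
by rewrite mem_orth.
Qed.

Lemma line_weight_peak p j : p \in pg -> j \in slots ->
  5 * peak [seq slot j z | z <- class_points p] + line_weight (orth_nth p j) <= 15 + class_size p.
Proof.
move=> hp hj; have [e he ->] := peak_segment_size hp hj; have [hl hpl] := orth_nthP hp hj.
exact: segment_size_bound.
Qed.

Lemma class_size_le_line_weight p l : p \in orth l -> class_size p <= line_weight l.
Proof. by move=> hp; rewrite /line_weight (bigD1_seq p) ?uniq_orth //= leq_addr. Qed.

Lemma sum_orth l (F : vec -> nat) :
  \sum_(p <- orth l) F p = \sum_(p <- pg) (p \in orth l) * F p.
Proof.
rewrite big_filter big_mkcond.
apply: eq_big_seq => p hp.
by rewrite mem_filter hp andbT; case: eqP; rewrite ?mul1n.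
Qed.

Lemma sum_class_size : \sum_(p <- pg) class_size p = size s.
Proof.
transitivity (\sum_(p <- pg) count (fun z => (z.1 == p) && xpredT z) s).
  by apply: eq_bigr => p _; apply: eq_count => z; rewrite andbT.
rewrite sum_count_fst ?uniq_pg // -[RHS](count_predT s).
by apply: eq_in_count => z /sub_s[-> _].
Qed.

(** The six lines through [p] cover [p] six times and every other point once. *)
Lemma sum_line_weight_through p : p \in pg ->
  \sum_(l <- pg) (p \in orth l) * line_weight l = size s + 5 * class_size p.
Proof.
move=> hp; transitivity (\sum_(l <- pg) \sum_(q <- pg) (p \in orth l) * ((q \in orth l) * class_size q)).
  by apply: eq_bigr => l _; rewrite /line_weight sum_orth big_distrr.
rewrite exchange_big /=.
transitivity (\sum_(q <- pg) (class_size q + 5 * ((p == q) * class_size p))).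
  apply: eq_big_seq => q hq.
  transitivity ((1 + 5 * (p == q)) * class_size q).
    rewrite -(count_lines hp hq) -sum1_count big_distrl [RHS]big_mkcond /=.
    by apply: eq_bigr => l _; case: (p \in _); case: (q \in _); rewrite ?mul1n.
  by case: eqP => [->|]; lia.
rewrite big_split /= sum_class_size -big_distrr /= (bigD1_seq p) ?uniq_pg //= eqxx mul1n.
by rewrite big1 ?addn0 // => q; rewrite eq_sym => /negbTE->.
Qed.

Lemma sum_line_weight_slots p : p \in pg ->
  \sum_(j <- slots) line_weight (orth_nth p j) = size s + 5 * class_size p.
Proof.
move=> hp; rewrite -(sum_line_weight_through hp) -(big_map (orth_nth p) xpredT line_weight) -orthE //.
rewrite sum_orth; apply: eq_big_seq => l hl.
by rewrite (mem_orth hl hp).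
Qed.

Lemma sum_line_weight : \sum_(l <- pg) line_weight l = 6 * size s.
Proof.
transitivity (\sum_(l <- pg) \sum_(p <- pg) (p \in orth l) * class_size p).
  by apply: eq_bigr => l _; apply: sum_orth.
rewrite exchange_big /= -sum_class_size big_distrr /=.
apply: eq_big_seq => p hp; rewrite -big_distrl /=; congr (_ * _).
transitivity (count (fun l => (p \in orth l) && (p \in orth l)) pg).
  2: by rewrite count_lines // eqxx.
rewrite -sum1_count [RHS]big_mkcond /=.
by apply: eq_bigr => l _; rewrite andbb; case: (p \in _).
Qed.

(** One factor is expanded into class sizes; [sum_line_weight_through] then applies at each
    point. *)
Lemma sum_line_weight_square :
  \sum_(l <- pg) line_weight l ^ 2 = size s ^ 2 + 5 * \sum_(p <- pg) class_size p ^ 2.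
Proof.
transitivity (\sum_(l <- pg) \sum_(p <- pg) class_size p * ((p \in orth l) * line_weight l)).
  apply: eq_bigr => l _; rewrite -mulnn {1}/line_weight sum_orth big_distrl /=.
  by apply: eq_bigr => p _; lia.
rewrite exchange_big -[in RHS]mulnn -{1}sum_class_size big_distrl big_distrr -big_split /=.
apply: eq_big_seq => p hp.
by rewrite -big_distrr /= sum_line_weight_through // mulnDr -mulnn; lia.
Qed.

(** * Excluding an arc of 44 points *)

Hypothesis size_s : size s = 44.

Lemma peaks_le3 p : p \in pg -> all (fun m => m <= 3) (peaks (class_points p)).
Proof.
move=> hp; apply/allP => _ /mapP[j hj ->].
by have := line_weight_peak hp hj; have := class_size_le_line_weight (orth_nthP hp hj).2; lia.
Qed.

Lemma peaks_class_points P n p : all (peaks_check P) (combinations n grid) -> p \in pg ->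
  class_size p = n -> P (peaks (class_points p)).
Proof.
move=> h hp Up; apply: (peaks_checkP h); rewrite ?uniq_class_points ?size_class_points ?peaks_le3 //.
exact: sub_class_points.
Qed.

Lemma sum_line_weight_slots_le p (F : nat -> nat) : p \in pg ->
  {in slots, forall j, line_weight (orth_nth p j) <= F (peak [seq slot j z | z <- class_points p])} ->
  44 + 5 * class_size p <= sumn [seq F m | m <- peaks (class_points p)].
Proof.
move=> hp h; rewrite -size_s -sum_line_weight_slots // sumnE !big_map.
by rewrite big_seq [X in _ <= X]big_seq; apply: leq_sum.
Qed.

(** The six bounds must reach 44 + 5 u, so five times the sum of the peaks m is at most 46 + u. For
    u = 5 this contradicts [peaks5]. For u > 5 pigeonhole gives m >= 2 throughout, and m >= 3 if u >
    10, while m <= 3 forces u <= 15. *)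
Lemma class_size_le4 : {in pg, forall p, class_size p <= 4}.
Proof.
move=> p hp; rewrite leqNgt; apply/negP => U5.
have : 44 + 5 * class_size p <= sumn [seq 15 + class_size p - 5 * m | m <- peaks (class_points p)].
  by apply: sum_line_weight_slots_le => // j hj; have := line_weight_peak hp hj; lia.
have := peaks_class_points peaks5_check hp; have := peaks_le3 hp.
have : all (fun m => class_size p <= 5 * m) (peaks (class_points p)).
  apply/allP => _ /mapP[j hj ->]; rewrite -size_class_points -(size_map (slot j)).
  by apply: size_peak => _ /mapP[z /(sub_class_points hp) hz ->]; apply: slot_F5.
rewrite /peaks5 /peaks; move: (fun j => peak _) => m.
rewrite /slots /=; lia.
Qed.

Lemma class_size_le3 : {in pg, forall p, class_size p <= 3}.
Proof.
move=> p hp; have := class_size_le4 hp; rewrite leq_eqVlt => /predU1P[U4|//].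
have := sum_line_weight_slots_le (F := fun m => minn 13 (19 - 5 * m)) hp.
have := peaks_class_points peaks4_check hp U4; rewrite /peaks4 => h1 h2.
suff /h2 : {in slots, forall j, line_weight (orth_nth p j) <=
    minn 13 (19 - 5 * peak [seq slot j z | z <- class_points p])} by lia.
move=> j hj; have := line_weight_peak hp hj; have [hl hpl] := orth_nthP hp hj.
by have := line_weight_le13 hl class_size_le4 hpl U4; lia.
Qed.

Lemma class_size_le2 : {in pg, forall p, class_size p <= 2}.
Proof.
move=> p hp; have := class_size_le3 hp; rewrite leq_eqVlt => /predU1P[U3|//].
have := sum_line_weight_slots_le (F := fun m => minn 11 (18 - 5 * m)) hp.
have := peaks_class_points peaks3_check hp U3; rewrite /peaks3 => h1 h2.
suff /h2 : {in slots, forall j, line_weight (orth_nth p j) <=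
    minn 11 (18 - 5 * peak [seq slot j z | z <- class_points p])} by lia.
move=> j hj; have := line_weight_peak hp hj; have [hl hpl] := orth_nthP hp hj.
by have := line_weight_le11 hl class_size_le3 hpl U3; lia.
Qed.

Definition doubled (l p : vec) : bool :=
  [&& p \in orth l, class_size p == 2 & has (fun e => 1 < segment_size l p e) F5].

Lemma doubled_exists p : p \in pg -> class_size p = 2 -> has (fun l => doubled l p) pg.
Proof.
move=> hp Up; have /mapP[j hj] := peaks_class_points peaks2_check hp Up.
have [e he ->] := peak_segment_size hp hj => G2; have [hl hpl] := orth_nthP hp hj.
apply/hasP; exists (orth_nth p j) => //; rewrite /doubled hpl Up eqxx !andTb.
by apply/hasP; exists e; rewrite -?G2.
Qed.

(** The product (w - 10) (w - 11) is nonnegative at integers and at least 12 for w <= 7 = 15 + 2 -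
    10; at most one class is doubled on [l]. *)
Lemma line_weight_quadratic l : l \in pg ->
  21 * line_weight l + 12 * \sum_(p <- pg) doubled l p <= line_weight l ^ 2 + 110.
Proof.
move=> hl; have [/hasP[p hp dp]|/hasPn h] := boolP (has (doubled l) pg).
  have /and3P[hpl /eqP Up /hasP[e he Ge]] := dp.
  have W7 : line_weight l <= 7 by have := segment_size_bound hl hpl he; lia.
  rewrite (bigD1_seq p) ?uniq_pg //= dp big1 => [|q nqp].
    by move: W7; case: (line_weight l) => [|[|[|[|[|[|[|[|]]]]]]]].
  apply/eqP; rewrite eqb0; apply: contra nqp => /and3P[hql _ /hasP[e' he' Ge']].
  exact/eqP/(double_segment_unique hl hql hpl he' he).
rewrite big_seq big1 => [|p /h/negbTE->//].
by have [?|?] := leqP (line_weight l) 10; nia.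
Qed.

Lemma no_arc_44 : False.
Proof.
have lines : \sum_(l <- pg) (21 * line_weight l + 12 * \sum_(p <- pg) doubled l p) <=
    \sum_(l <- pg) (line_weight l ^ 2 + 110).
  by rewrite big_seq [X in _ <= X]big_seq; apply: leq_sum => l /line_weight_quadratic.
(* The bound 2 + 3 u for 5 u^2 is tight at u = 1; at u = 2 the missing 12 comes from a doubled
   pair. *)
have points : \sum_(p <- pg) 5 * class_size p ^ 2 <=
    \sum_(p <- pg) (12 * \sum_(l <- pg) doubled l p + 2 + 3 * class_size p).
  rewrite big_seq [X in _ <= X]big_seq; apply: leq_sum => p hp.
  have := class_size_le2 hp; have := doubled_exists hp.
  case: (class_size p) => [|[|[|//]]] h _; [lia | lia |].
  have /hasP[l hl dl] := h erefl; rewrite (bigD1_seq l) ?uniq_pg //= dl; lia.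
have const k : \sum_(p <- pg) k = 31 * k.
  by rewrite big_const_seq count_predT iter_addn_0 mulnC.
have scale k (F : vec -> nat) : \sum_(p <- pg) k * F p = k * \sum_(p <- pg) F p.
  by rewrite big_distrr.
rewrite big_split [X in _ <= X]big_split /= 2!scale const sum_line_weight sum_line_weight_square size_s in lines.
rewrite [X in _ <= X]big_split [X in _ <= X + _]big_split /= 3!scale const sum_class_size exchange_big size_s in points.
(* With D doubled pairs and Q the sum of the squared class sizes, [lines] reads 12 D + 198 <= 5 Q
   and [points] gives 5 Q <= 12 D + 194. *)
by move: lines points => /=; lia.
Qed.

End Arc.

Lemma arc_size_le43 (c : vec -> vec -> nat) (s : seq (vec * vec)) :
  uniq s -> {in s, forall z, z.1 \in pg /\ z.2 \in lifts z.1} ->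
  {in pg, forall l, {in lifts l, forall b,
    count (fun z => (dot z.1 l %% 5 == 0) &&
      ((c z.1 l + dot z.2 l + dot b z.1) %% 5 == 0)) s <= 3}} ->
  size s <= 43.
Proof.
move=> us sub_s line_s; rewrite leqNgt; apply/negP => s44.
apply: (@no_arc_44 c (take 44 s)); rewrite ?take_uniq ?size_take_min ?(minn_idPl s44) //.
  by move=> z /mem_take/sub_s.
move=> l hl b hb; apply: leq_trans (line_s l hl b hb).
exact/leq_count_subseq/take_subseq.
Qed.

(** * Coordinates of the projective Hjelmslev planes *)

Local Open Scope ring_scope.

(** Since w_i = 1, the equation determines x_i; the rows e_j - w_j e_i of [B], for the two indices j
    other than i, form a basis. *)
Lemma hyperplane_phg_line (R : finComNzRingType) (w : 'rV[R]_3) (i : 'I_3) :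
  w 0 i = 1 -> phg_line [set x : 'rV[R]_3 | x *m w^T == 0].
Proof.
move=> wi; pose B : 'M[R]_(2, 3) := \matrix_(j, k)
  ((k == lift i j)%:R - w 0 (lift i j) * (k == i)%:R).
have BE (d : 'rV_2) j : (d *m B) 0 (lift i j) = d 0 j.
  rewrite mxE (bigD1 j) //= mxE eqxx eq_sym (negbTE (neq_lift _ _)) mulr0 subr0 mulr1.
  rewrite big1 ?addr0 // => k nkj.
  by rewrite mxE (inj_eq lift_inj) eq_sym (negbTE nkj) eq_sym (negbTE (neq_lift _ _)) mulr0 subr0 mulr0.
have Bi (d : 'rV_2) : (d *m B) 0 i = - \sum_j d 0 j * w 0 (lift i j).
  rewrite mxE -sumrN; apply: eq_bigr => j _.
  by rewrite mxE eqxx (negbTE (neq_lift _ _)) sub0r mulr1 mulrN.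
have dotE (x : 'rV[R]_3) : (x *m w^T) 0 0 = x 0 i + \sum_j x 0 (lift i j) * w 0 (lift i j).
  rewrite mxE (bigD1_ord i) //= mxE wi mulr1; congr (_ + _).
  by apply: eq_bigr => j _; rewrite mxE.
apply/existsP; exists B; apply/andP; split.
  apply/injectiveP => d e h; apply/rowP => j.
  by rewrite -BE h BE.
apply/eqP/setP => x; rewrite inE; apply/eqP/imsetP => [xw|[d _ ->]].
  have {}xw : (x *m w^T) 0 0 = 0 by rewrite xw mxE.
  exists (\row_j x 0 (lift i j)) => //; apply/rowP => k.
  have [j ->|->] := unliftP i k; first by rewrite BE mxE.
  rewrite Bi; move/eqP: xw; rewrite dotE addr_eq0 => /eqP ->; congr (- _).
  by apply: eq_bigr => j _; rewrite mxE.
apply/matrixP => a b; rewrite !ord1 dotE Bi addrC.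
rewrite [RHS]mxE; apply/eqP; rewrite subr_eq0; apply/eqP.
by apply: eq_bigr => j _; rewrite BE.
Qed.

(** The carry [n] is kept because 5 is nonzero in Z_25. *)
Lemma inv_mod5 a : a \in F5 -> a != 0%N -> exists m n, (m * a = 1 + 5 * n)%N.
Proof.
rewrite !inE => /or4P[|||/orP[]] /eqP-> // _.
- by exists 1%N, 0%N.
- by exists 3, 1%N.
- by exists 2, 1%N.
- by exists 4, 3.
Qed.

(** * Codes of points and lines over a chain ring *)

Section ChainRing.

Variables (R : finComNzRingType) (theta : R) (kappa : nat).
Hypothesis theta_neq0 : theta != 0.
Hypothesis theta_sq : theta * theta = 0.
Hypothesis five : 5%:R = kappa%:R * theta.
Hypothesis digits : forall r : R,
  exists a b, [/\ a \in F5, b \in F5 & r = a%:R + b%:R * theta].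

Definition row3 (x y z : R) : 'rV[R]_3 := \row_j [:: x; y; z]`_j.

Definition enc (a b : nat) : R := a%:R + b%:R * theta.

Definition code_row (z : vec * vec) : 'rV[R]_3 :=
  row3 (enc z.1.1.1 z.2.1.1) (enc z.1.1.2 z.2.1.2) (enc z.1.2 z.2.2).

Definition row_span (v : 'rV[R]_3) : {set 'rV[R]_3} := [set d *m v | d : 'rV[R]_1].

Lemma five_theta : 5%:R * theta = 0.
Proof. by rewrite five -mulrA theta_sq mulr0. Qed.

(** The product is p.l + (a.l + b.p) theta, and p.l = 5 m = kappa m theta, so it is a multiple of 5
    theta = 0. *)
Lemma enc_dot p a l b : (dot p l %% 5 == 0)%N ->
  ((kappa * (dot p l %/ 5) + dot a l + dot b p) %% 5 == 0)%N ->
  code_row (p, a) *m (code_row (l, b))^T = 0.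
Proof.
move=> /dvdnP[m hm] /dvdnP[n]; rewrite hm mulnK // => hn.
apply/matrixP => i j; rewrite !ord1 mxE !big_ord_recl big_ord0 !mxE /= /enc.
have : (dot p l)%:R + (dot a l + dot b p)%:R * theta = 0.
  rewrite hm natrM five mulrA -natrM -mulrDl -natrD mulnC addnA hn natrM -mulrA.
  by rewrite five_theta mulr0.
clear m hm n hn; rewrite /dot.
case: p a l b => [[p1 p2] p3] [[a1 a2] a3] [[l1 l2] l3] [[b1 b2] b3] /=.
rewrite !natrD !natrM => h.
(* Adding a multiple of theta^2 = 0 cancels the a.b term, so that [h] matches by a polynomial
   identity. *)
set X := (LHS); have -> : X = X + (a1%:R * b1%:R + a2%:R * b2%:R + a3%:R * b3%:R) * - (theta * theta).
  by rewrite theta_sq oppr0 mulr0 addr0.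
by rewrite -h /X; ring.
Qed.

(** For r = a + b theta, r theta = a theta, so a is nonzero with an inverse m modulo 5; then m r = 1
    + k theta has inverse 1 - k theta. *)
Lemma theta_unit r : r * theta != 0 -> exists u, u * r = 1.
Proof.
have [a [b [aF _ ->]]] := digits r.
rewrite mulrDl -mulrA theta_sq mulr0 addr0 => h.
have [|m [n mn]] := inv_mod5 aF.
  by apply: contraNneq h => ->; rewrite mul0r.
pose k : R := (n * kappa + m * b)%:R.
exists ((1 - k * theta) * m%:R).
have e : m%:R * a%:R = 1 + (n * kappa)%:R * theta.
  by rewrite -natrM mn natrD natrM five natrM; ring.
have -> : (1 - k * theta) * m%:R * (a%:R + b%:R * theta) =
  (1 - k * theta) * (m%:R * a%:R + (m * b)%:R * theta) by rewrite natrM; ring.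
rewrite e -addrA -mulrDl -natrD -/k.
have -> : (1 - k * theta) * (1 + k * theta) = 1 - k * k * (theta * theta) by ring.
by rewrite theta_sq mulr0 subr0.
Qed.

(** If the digit a were nonzero, multiplying a theta = 0 by an inverse of a modulo 5 would give
    theta = 0. *)
Lemma digits_ideal r : r * theta = 0 -> exists2 b, b \in F5 & r = enc 0 b.
Proof.
have [a [b [aF bF ->]]] := digits r.
rewrite mulrDl -mulrA theta_sq mulr0 addr0 => h.
have [a0|/(inv_mod5 aF)[m [n mn]]] := eqVneq a 0%N; first by exists b; rewrite // a0.
case/eqP: theta_neq0.
have : (m * a)%:R * theta = 0 by rewrite natrM -mulrA h mulr0.
by rewrite mn natrD mulrDl mul1r natrM -mulrA mulrCA five_theta mulr0 addr0.
Qed.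

Lemma row_span_scale (v : 'rV[R]_3) u r : u * r = 1 -> row_span (u *: v) = row_span v.
Proof.
move=> ur; apply/setP => x; apply/imsetP/imsetP => -[d _ ->].
  by exists (u *: d); rewrite // -scalemxAl -scalemxAr.
exists (r *: d); rewrite // -scalemxAl -scalemxAr scalerA mulrC ur.
by rewrite scale1r.
Qed.

Lemma row3E (v : 'rV[R]_3) : v = row3 (v 0 0) (v 0 1) (v 0 2%:R).
Proof.
by apply/rowP => -[[|[|[|//]]] h]; rewrite mxE /=; congr (v _ _); apply/val_inj.
Qed.

(** The first coordinate not annihilated by theta is a unit and is scaled to 1; earlier ones are
    multiples of theta. If theta annihilated all three, theta and 0 would have the same image,
    against freeness. *)
Lemma phg_point_code P : phg_point P ->
  exists z, [/\ z.1 \in pg, z.2 \in lifts z.1 & P = row_span (code_row z)].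
Proof.
move=> /existsP[v /andP[/injectiveP inj /eqP ->]].
rewrite -/(row_span v).
have gridP x y : x \in F5 -> y \in F5 -> (x, y) \in grid.
  by move=> hx hy; apply/allpairsP; exists (x, y).
have [v0|/theta_unit[u hu]] := eqVneq (v 0 0 * theta) 0; last first.
  have [p1 [a1 [hp1 ha1 e1]]] := digits (u * v 0 1).
  have [p2 [a2 [hp2 ha2 e2]]] := digits (u * v 0 2%:R).
  exists ((1%N, p1, p2), (0%N, a1, a2)); split.
  - rewrite /pg inE mem_cat; apply/or3P/Or33.
    exact: (map_f (fun z => (1%N, z.1, z.2)) (gridP _ _ hp1 hp2)).
  - exact: (map_f (fun z => (0%N, z.1, z.2)) (gridP _ _ ha1 ha2)).
  rewrite -(row_span_scale v hu); congr row_span.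
  by rewrite [LHS]row3E !mxE hu e1 e2 /code_row /enc /= mul0r addr0.
have [v1|/theta_unit[u hu]] := eqVneq (v 0 1 * theta) 0; last first.
  have [|a0 ha0 e0] := @digits_ideal (u * v 0 0); first by rewrite -mulrA v0 mulr0.
  have [p2 [a2 [hp2 ha2 e2]]] := digits (u * v 0 2%:R).
  exists ((0%N, 1%N, p2), (a0, 0%N, a2)); split.
  - rewrite /pg inE mem_cat; apply/or3P/Or32.
    exact: (map_f (fun t => (0%N, 1%N, t)) hp2).
  - exact: (map_f (fun z => (z.1, 0%N, z.2)) (gridP _ _ ha0 ha2)).
  rewrite -(row_span_scale v hu); congr row_span.
  by rewrite [LHS]row3E !mxE hu e0 e2 /code_row /enc /= mul0r addr0.
have [v2|/theta_unit[u hu]] := eqVneq (v 0 2%:R * theta) 0; last first.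
  have [|a0 ha0 e0] := @digits_ideal (u * v 0 0); first by rewrite -mulrA v0 mulr0.
  have [|a1 ha1 e1] := @digits_ideal (u * v 0 1); first by rewrite -mulrA v1 mulr0.
  exists ((0%N, 0%N, 1%N), (a0, a1, 0%N)); split.
  - by rewrite /pg mem_head.
  - exact: (map_f (fun z => (z.1, z.2, 0%N)) (gridP _ _ ha0 ha1)).
  rewrite -(row_span_scale v hu); congr row_span.
  by rewrite [LHS]row3E !mxE hu e0 e1 /code_row /enc /= mul0r addr0.
have /inj/matrixP/(_ 0 0) : theta%:M *m v = 0 *m v.
  rewrite mul_scalar_mx mul0mx [v]row3E; apply/rowP => -[[|[|[|//]]] h];
  by rewrite !mxE /= mulrC.
by rewrite !mxE /= mulr1n => /eqP; rewrite (negbTE theta_neq0).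
Qed.

Lemma code_row_unit l b : l \in pg -> b \in lifts l -> exists i, code_row (l, b) 0 i = 1.
Proof.
rewrite /pg inE mem_cat => /or3P[/eqP->|/mapP[t _ ->]|/mapP[z _ ->]] /mapP[z' _ ->].
- by exists 2%:R; rewrite mxE /= /enc mul0r addr0.
- by exists 1; rewrite mxE /= /enc mul0r addr0.
- by exists 0; rewrite mxE /= /enc mul0r addr0.
Qed.

Lemma chain_ring_m3_le43 : (m_arc R 3 <= 43)%N.
Proof.
apply/bigmax_leqP => K /andP[/forall_inP Kpt /forallP Kline].
have /fin_all_exists[f hf] : forall P : {set 'rV[R]_3}, exists z : vec * vec,
    P \in K -> [/\ z.1 \in pg, z.2 \in lifts z.1 & P = row_span (code_row z)].
  move=> P; have [/Kpt/phg_point_code[z hz]|_] := boolP (P \in K); first by exists z.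
  by exists ((0, 0, 0), (0, 0, 0))%N.
rewrite cardE -(size_map f).
(* Here [c] is the carry of p.l, which kappa turns into a coefficient of theta. *)
apply: (@arc_size_le43 (fun p l => kappa * (dot p l %/ 5))%N).
- rewrite map_inj_in_uniq ?enum_uniq // => P Q; rewrite !mem_enum.
  by move=> /hf[_ _ eP] /hf[_ _ eQ] e; rewrite eP eQ e.
- by move=> _ /mapP[P + ->]; rewrite mem_enum => /hf[].
move=> l hl b hb; have [i hi] := code_row_unit hl hb.
have := Kline [set x : 'rV[R]_3 | x *m (code_row (l, b))^T == 0].
rewrite (hyperplane_phg_line hi) => h; apply: leq_trans h.
rewrite count_map -size_filter cardE; apply: uniq_leq_size; first by rewrite filter_uniq ?enum_uniq.
move=> P; rewrite mem_filter !mem_enum => /andP[/andP[h1 h2] PK]; rewrite inE PK.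
have [_ _ eP] := hf P PK; apply/subsetP => x; rewrite eP => /imsetP[d _ ->].
rewrite inE -mulmxA; case: (f P) h1 h2 => p a /= h1 h2.
by rewrite enc_dot // mulmx0.
Qed.

End ChainRing.

(** * The rings Z_25 and F_5[X]/(X^2) *)

Lemma Z25_digits (r : 'Z_25) :
  exists a b, [/\ a \in F5, b \in F5 & r = a%:R + b%:R * 5%:R].
Proof.
exists (r %% 5)%N, (r %/ 5)%N; split; first exact: mod5_F5.
  have : (r %/ 5 < 5)%N by rewrite ltn_divLR // ltn_ord.
  by case: (_ %/ _)%N => [|[|[|[|[|]]]]].
by rewrite -natrM -natrD addnC -divn_eq natr_Zp.
Qed.

Notation S5q := {poly %/ ('X^2 : {poly 'F_5})}.

(** Needed because [{poly %/ p}] reduces modulo [mk_monic p]. *)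
Lemma mk_monic_X2 : mk_monic ('X^2 : {poly 'F_5}) = 'X^2.
Proof. exact: mk_monic_Xn. Qed.

Lemma size_mk_monic_X2 : size (mk_monic ('X^2 : {poly 'F_5})) = 3.
Proof. by rewrite mk_monic_X2 size_polyXn. Qed.

Lemma S5_theta_sq : ('qX : S5q) * 'qX = 0.
Proof.
rewrite -in_qpolyM; apply/val_inj; rewrite /= mk_monic_X2 -expr2.
by rewrite Pdiv.RingMonic.rmodpp ?monicXn.
Qed.

Lemma S5_theta_neq0 : ('qX : S5q) != 0.
Proof.
apply/eqP => /(congr1 (fun q : S5q => q : {poly 'F_5})).
rewrite qpolyXE ?size_polyXn ?monicXn // => /eqP.
by rewrite polyX_eq0.
Qed.

Lemma S5_five : (5%:R : S5q) = 0.
Proof.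
have /(_ 5) := pchar_qpoly ('X^2 : {poly 'F_5}).
by rewrite (pchar_Fp (isT : prime 5)) inE => /andP[_ /eqP].
Qed.

Lemma S5_digits (r : S5q) :
  exists a b, [/\ a \in F5, b \in F5 & r = a%:R + b%:R * 'qX].
Proof.
have ltF (x : 'F_5) : (x : nat) \in F5.
  by have := ltn_ord x; case: (nat_of_ord x) => [|[|[|[|[|]]]]].
exists (nat_of_ord r`_0), (nat_of_ord r`_1); split=> //.
transitivity (in_qpoly ('X^2 : {poly 'F_5}) ((nat_of_ord r`_0)%:R + (nat_of_ord r`_1)%:R * 'X)).
  apply/val_inj/esym; apply: etrans (in_qpoly_small _) _.
    rewrite [X in (_ < X)%N]size_mk_monic_X2 -!polyC_natr mul_polyC.
    apply: leq_ltn_trans (size_polyD _ _) _; rewrite gtn_max.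
    rewrite (leq_ltn_trans (size_polyC_leq1 _)) //.
    by rewrite (leq_ltn_trans (size_scale_leq _ _)) // size_polyX.
  apply/polyP => -[|[|i]]; rewrite coefD -!polyC_natr coefC coefCM coefX /=.
  - by rewrite mulr0 addr0 natr_Zp.
  - by rewrite mulr1 add0r natr_Zp.
  rewrite mulr0 addr0 nth_default //.
  have := size_mk_monic r; rewrite [X in (_ < X)%N]size_mk_monic_X2 ltnS.
  by move=> /leq_trans->.
by rewrite rmorphD rmorphM !rmorph_nat.
Qed.

Theorem theorem4p22 : (m_arc 'Z_25 3 <= 43)%N /\ (m_arc S5 3 <= 43)%N.
Proof.
split.
  apply: (@chain_ring_m3_le43 _ 5%:R 1 _ _ _ Z25_digits).
  - by [].
  - exact/val_inj.
  - by rewrite mul1r.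
apply: (@chain_ring_m3_le43 _ ('qX : S5) 0 S5_theta_neq0 S5_theta_sq _ S5_digits).
by rewrite mul0r; exact: S5_five.
Qed.
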